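(* In the setting described in the context (in particular $\beta>\beta_0$, with $\kappa>0$ as there), there is a constant $\mathrm{Const}\in(0,\infty)$ such that the invariant measure $\nu$ satisfies $$\nu\left(e^{\delta f}\right)<\mathrm{Const}\; e^{\frac{\delta^2}{\kappa}\|\Gamma(f)\|_\infty}\,e^{\delta\,\nu(f)}$$ for every $\delta$ and every differentiable function $f$ for which $\nu(f)$ is well defined and $$\frac{\delta^2}{\kappa}\|\Gamma(f)\|_\infty\le1 .$$
   Context: Let $N,n,M,m$ be positive integers with $n\ge N$, $m\le M$. Let $X_1,\dots,X_M$ be smooth vector fields on $\mathbb{R}^N$ satisfying the Hörmander condition with step $K>1$, and let $Z_1,\dots,Z_n$ be an adapted family: $Z_k=X_k$ for $k\le M$, $Z_{M+1},\dots,Z_n$ are commutators of the $X_i$ of length between $2$ and $K$, and $Z_1,\dots,Z_n$ span $\mathbb{R}^N$ at every point. Assume there are real constants $c_{kjl}$ with $[Z_k,X_j]=\sum_{l=1}^nc_{kjl}Z_l$ for $k=1,\dots,n$, $j=1,\dots,m$. Let $D$ be a vector field on $\mathbb{R}^N$ (dilation generator) with $[Z_k,D]=\lambda_kZ_k$ for some $\lambda_k>0$, $k=1,\dots,n$. Let $\beta\in(0,\infty)$ and let $G=(G_{ii'})_{i,i'=1}^m$ be a constant real matrix with $G^*+I>0$, $G^*_{ii'}=\frac12(G_{ii'}+G_{i'i})$. For $k\in\mathbb{Z}^d$ let $Z_{k,r}$, $X_{k,i}$, $D_k$ be copies of $Z_r$, $X_i$, $D$ acting on the $k$-th coordinate $\omega_k$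 of $\omega\in(\mathbb{R}^N)^{\mathbb{Z}^d}$. Put $$\mathcal{L}^{(1)}_k=\sum_{i=1}^mX_{k,i}^2-\beta D_k+\sum_{i,i'=1}^mG_{ii'}X_{k,i}X_{k,i'},\qquad \mathcal{L}^{(2)}_k=\sum_{i=1}^m\alpha_{k,i}X_{k,i},$$ where $\alpha_{k,i}=\alpha_{k,i}(\omega)$ are smooth functions of finite range $R$: $\alpha_{j,i}$ depends only on coordinates near $j$, with $Z_{k,r}\alpha_{j,i}=0$ whenever $|k-j|>R$, where $|k-j|=\sum_{l=1}^d|k_l-j_l|$. The quantities $\|Z_{k,r}\alpha_{j,i}\|_\infty$ and $\|\alpha_{k,i}\|_\infty$ are bounded uniformly in $k,j\in\mathbb{Z}^d$ (and in $r,i$). For finite $\mathbf{\Lambda}\subset\mathbb{Z}^d$, $(P_t^{\mathbf{\Lambda}})_{t\ge0}$ is the Markov semigroup with generator $\mathcal{L}_{\mathbf{\Lambda}}=\sum_{k\in\mathbb{Z}^d}\mathcal{L}^{(1)}_k+\sum_{k\in\mathbf{\Lambda}}\mathcal{L}^{(2)}_k$, and $P_tf=\lim_{\mathbf{\Lambda}\uparrow\mathbb{Z}^d}P_t^{\mathbf{\Lambda}}f$ (uniform limit) is the infinite-dimensional semigroup. Put $\Gamma(f)=\sum_{k\in\mathbb{Z}^d}\sum_{r=1}^n|Z_{k,r}f|^2$ and $\bar\Gamma(f)=\sum_{j\in\mathbb{Z}^d}\sum_{i,i'=1}^m(G_{ii'}+\delta_{ii'})(X_{j,i}f)(X_{j,i'}f)$;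 it is assumed that $\bar\Gamma(f)\le\Gamma(f)$ (as is the case when $G=0$). $\|\cdot\|_\infty$ is the supremum norm over configurations. There is $\beta_0\in(0,\infty)$ such that for $\beta>\beta_0$ there is a constant $\kappa>0$ with $\Gamma(P_tf)\le e^{-\kappa t}P_t\Gamma(f)$ and $P_t(f^2)-(P_tf)^2\le\frac2\kappa(1-e^{-\kappa t})P_t\Gamma(f)$ for all $t>0$ and differentiable $f$; we fix such $\beta$ and $\kappa$. $\nu$ is the unique $P_t$-invariant probability measure carried by $\Omega=\{\omega\in(\mathbb{R}^N)^{\mathbb{Z}^d}:\sum_k(1+|k|)^{-\zeta}d(\omega_k)<\infty\}$, where $|k|=\sum_{l=1}^d|k_l|$, $\zeta\in\mathbb{N}$ is such that $\sum_{k\in\mathbb{Z}^d}(1+|k|)^{-\zeta}<\infty$, and $d(x)=d(x,0)$ with $d$ the control distance of $X_1,\dots,X_M$ on $\mathbb{R}^N$; it is the limit of $P_tf(\omega)$ as $t\to\infty$ for $\omega\in\Omega$. *)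

(* Defs.v *)
From HB Require Import structures.
From mathcomp Require Import all_boot all_order all_algebra.
From mathcomp Require Import all_classical all_reals all_analysis.

Set Implicit Arguments.
Unset Strict Implicit.
Unset Printing Implicit Defensive.

Import Order.TTheory GRing.Theory Num.Theory.
Import numFieldNormedType.Exports.

Local Open Scope classical_set_scope.
Local Open Scope ring_scope.

Definition vfield (R : realType) (N : nat) := 'rV[R]_N -> 'rV[R]_N.

Fixpoint vfield_Ck (R : realType) (N p : nat) (V : vfield R N) : Prop :=
  continuous V /\
  (if p is q.+1 then
     forall v, (forall x, derivable V x v) /\ vfield_Ck q (fun x => 'D_v V x)
   else True).

Definition smooth_vfield (R : realType) (N : nat) (V : vfield R N) : Prop :=
  forall p, vfield_Ck p V.

(* [V, W] = V W - W V as derivations, i.e. its coefficients are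
   V(W_c) - W(V_c). *)
Definition lie_bracket (R : realType) (N : nat) (V W : vfield R N)
    : vfield R N :=
  fun x => 'D_(V x) W x - 'D_(W x) V x.

Inductive commutator (R : realType) (N M : nat) (X : 'I_M -> vfield R N)
    : nat -> vfield R N -> Prop :=
| Commutator1 i : commutator X 1 (X i)
| CommutatorB p q V W : commutator X p V -> commutator X q W ->
    commutator X (p + q) (lie_bracket V W).

Definition spans_everywhere (R : realType) (N n : nat)
    (Z : 'I_n -> vfield R N) : Prop :=
  forall x, row_full (\matrix_(k < n) Z k x).

Definition hormander (R : realType) (N M : nat) (X : 'I_M -> vfield R N)
    (K : nat) : Prop :=
  forall x, exists (p : nat) (U : 'I_p -> vfield R N),
    (forall i, exists2 l, (l <= K)%N & commutator X l (U i)) /\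
    row_full (\matrix_(i < p) U i x).

Definition adapted_family (R : realType) (N M n K : nat) (leMn : (M <= n)%N)
    (X : 'I_M -> vfield R N) (Z : 'I_n -> vfield R N) : Prop :=
  [/\ forall i : 'I_M, Z (widen_ord leMn i) = X i,
      forall k : 'I_n, (M <= k)%N ->
        exists2 l, (2 <= l <= K)%N & commutator X l (Z k)
    & spans_everywhere Z].

(* G^* + I > 0 for the symmetric part G^* of G. *)
Definition sym_part_plus_id_posdef (R : realType) (m : nat) (G : 'M[R]_m)
    : Prop :=
  forall v : 'rV[R]_m, v != 0 ->
    0 < (v *m (2^-1 *: (G + G^T) + 1%:M) *m v^T) 0 0.

(* Absolutely continuous curves from x to y with velocity
   sum_i a_i X_i and sum_i a_i^2 <= 1, written in integrated form. *)
Definition subunit_joins (R : realType) (N M : nat) (X : 'I_M -> vfield R N)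
    (x y : 'rV[R]_N) (T : R) : Prop :=
  exists (g : R -> 'rV[R]_N) (a : 'I_M -> R -> R),
    [/\ g 0 = x, g T = y, {within `[0, T], continuous g},
        (forall i, measurable_fun `[0, T] (a i)) /\
        (forall s : R, 0 <= s <= T -> \sum_(i < M) a i s ^+ 2 <= 1)
      & forall (t : R) c, 0 <= t <= T ->
          g t 0 c = x 0 c + \int[@lebesgue_measure R]_(s in `[0, t])
                              (\sum_(i < M) a i s * X i (g s) 0 c)].

Definition control_dist (R : realType) (N M : nat) (X : 'I_M -> vfield R N)
    (x y : 'rV[R]_N) : \bar R :=
  ereal_inf [set T%:E | T in [set T : R | 0 <= T /\ subunit_joins X x y T]].

Definition lattice (d : nat) := 'rV[int]_d.

Definition lnorm (d : nat) (k : lattice d) : nat := (\sum_(l < d) `|k 0%R l|)%N.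

(* Configurations carry the product topology and its Borel sigma-algebra
   (equal to the product sigma-algebra, as the lattice is countable). *)
Definition config (R : realType) (N d : nat) := lattice d -> 'rV[R]_N.

HB.instance Definition _ (R : realType) (N d : nat) :=
  GRing.Zmodule.copy (config R N d) (lattice d -> 'rV[R]_N).
HB.instance Definition _ (R : realType) (N d : nat) :=
  Topological.copy (config R N d) (prod_topology (fun _ : lattice d => 'rV[R]_N)).
HB.instance Definition _ (R : realType) (N d : nat) :=
  Pointed.copy (config R N d) (lattice d -> 'rV[R]_N).
HB.instance Definition _ (R : realType) (N d : nat) :=
  Measurable.copy (config R N d) (g_sigma_algebraType (@open (config R N d))).

Definition disp (R : realType) (N d : nat) (k : lattice d) (v : 'rV[R]_N)
    : config R N d :=
  fun j => if j == k then v else 0.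

(* Derivative of f at w along the vector v placed at site k. *)
Definition site_derive (R : realType) (N d : nat) (k : lattice d)
    (v : 'rV[R]_N) (f : config R N d -> R) (w : config R N d) : R :=
  'D_v (fun x : 'rV[R]_N => f (w + disp k x)) 0.

Definition site_vfield (R : realType) (N d : nat) (V : vfield R N)
    (k : lattice d) (f : config R N d -> R) : config R N d -> R :=
  fun w => site_derive k (V (w k)) f w.

(* Frechet differentiability in every finite set of coordinates, together
   with continuity for the product topology. *)
Definition config_differentiable (R : realType) (N d : nat)
    (f : config R N d -> R) : Prop :=
  continuous f /\
  forall (w : config R N d) (p : nat) (s : 'I_p -> lattice d),
    differentiable
      (fun v : 'M[R]_(p, N) => f (w + \sum_(i < p) disp (s i) (row i v)))
      (0 : 'M[R]_(p, N)).

Fixpoint config_Ck (R : realType) (N d p : nat) (f : config R N d -> R)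
    : Prop :=
  continuous f /\
  (if p is q.+1 then
     forall k v,
       (forall w, derivable (fun x : 'rV[R]_N => f (w + disp k x)) 0 v) /\
       config_Ck q (site_derive k v f)
   else True).

Definition config_smooth (R : realType) (N d : nat) (f : config R N d -> R)
    : Prop :=
  forall p, config_Ck p f.

Definition depends_on (R : realType) (N d : nat) (S : set (lattice d))
    (f : config R N d -> R) : Prop :=
  forall w w' : config R N d, (forall k, S k -> w k = w' k) -> f w = f w'.

Definition cylinder (R : realType) (N d : nat) (f : config R N d -> R)
    : Prop :=
  exists2 S : set (lattice d), finite_set S & depends_on S f.

(* Smooth functions of finitely many coordinates, with compact support in
   these coordinates. *)
Definition Ccinf_cylinder (R : realType) (N d : nat) (f : config R N d -> R)
    : Prop :=
  config_smooth f /\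
  exists S : set (lattice d), [/\ finite_set S, depends_on S f
    & exists r : R, forall w : config R N d,
        (exists2 k, S k & r < `|w k|) -> f w = 0].

Definition Gamma (R : realType) (N n d : nat) (Z : 'I_n -> vfield R N)
    (f : config R N d -> R) (w : config R N d) : \bar R :=
  \esum_(k in [set: lattice d])
    (\sum_(r < n) site_vfield (Z r) k f w ^+ 2)%:E.

Definition Gamma_bar (R : realType) (N m d : nat) (X : 'I_m -> vfield R N)
    (G : 'M[R]_m) (f : config R N d -> R) (w : config R N d) : \bar R :=
  \esum_(j in [set: lattice d])
    (\sum_(i < m) \sum_(i' < m) (G i i' + (i == i')%:R) *
       site_vfield (X i) j f w * site_vfield (X i') j f w)%:E.

Definition sup_Gamma (R : realType) (N n d : nat) (Z : 'I_n -> vfield R N)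
    (f : config R N d -> R) : \bar R :=
  ereal_sup (range (Gamma Z f)).

(* Boundedness makes P_t f and P_t (f ^ 2) meaningful for a Markov kernel. *)
Definition test_function (R : realType) (N n d : nat)
    (Z : 'I_n -> vfield R N) (f : config R N d -> R) : Prop :=
  [/\ config_differentiable f, exists C : R, forall w, `|f w| <= C
    & (sup_Gamma Z f < +oo)%E].

Definition L1 (R : realType) (N m d : nat) (X : 'I_m -> vfield R N)
    (D : vfield R N) (G : 'M[R]_m) (beta : R) (k : lattice d)
    (f : config R N d -> R) (w : config R N d) : R :=
  \sum_(i < m) site_vfield (X i) k (site_vfield (X i) k f) w
  - beta * site_vfield D k f w
  + \sum_(i < m) \sum_(i' < m)
      G i i' * site_vfield (X i) k (site_vfield (X i') k f) w.

Definition L2 (R : realType) (N m d : nat) (X : 'I_m -> vfield R N)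
    (alpha : lattice d -> 'I_m -> config R N d -> R) (k : lattice d)
    (f : config R N d -> R) (w : config R N d) : R :=
  \sum_(i < m) alpha k i w * site_vfield (X i) k f w.

(* On cylinder functions only finitely many terms of the first sum are
   nonzero. *)
Definition L_box (R : realType) (N m d : nat) (X : 'I_m -> vfield R N)
    (D : vfield R N) (G : 'M[R]_m) (beta : R)
    (alpha : lattice d -> 'I_m -> config R N d -> R) (Lam : set (lattice d))
    (f : config R N d -> R) (w : config R N d) : R :=
  \sum_(k \in [set: lattice d]) L1 X D G beta k f w +
  \sum_(k \in Lam) L2 X alpha k f w.

Definition finite_range (R : realType) (N n m d Rg : nat)
    (Z : 'I_n -> vfield R N)
    (alpha : lattice d -> 'I_m -> config R N d -> R) : Prop :=
  (forall (j : lattice d) i,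
    depends_on [set k : lattice d | (lnorm (k - j)%R <= Rg)%N] (alpha j i)) /\
  (forall (k j : lattice d) i r w, (Rg < lnorm (k - j)%R)%N ->
    site_vfield (Z r) k (alpha j i) w = 0).

Definition bounded_coefficients (R : realType) (N n m d : nat)
    (Z : 'I_n -> vfield R N)
    (alpha : lattice d -> 'I_m -> config R N d -> R) : Prop :=
  exists C : R,
    (forall j i w, `|alpha j i w| <= C) /\
    (forall k j i r w, `|site_vfield (Z r) k (alpha j i) w| <= C).

Definition kernel_family (R : realType) (N d : nat) :=
  R -> R.-pker (config R N d) ~> (config R N d).

Definition semi (R : realType) (N d : nat) (P : kernel_family R N d) (t : R)
    (f : config R N d -> R) (w : config R N d) : R :=
  \int[P t w]_w' f w'.

Definition markov_semigroup (R : realType) (N d : nat)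
    (P : kernel_family R N d) : Prop :=
  (forall w A, measurable A -> P 0 w A = \d_w A) /\
  (forall (s t : R) w A, 0 <= s -> 0 <= t -> measurable A ->
    P (s + t) w A = (\int[P s w]_w' P t w' A)%E).

(* L is the weak (bounded-pointwise) generator of P on smooth compactly
   supported cylinder functions. *)
Definition has_generator (R : realType) (N d : nat) (P : kernel_family R N d)
    (L : (config R N d -> R) -> config R N d -> R) : Prop :=
  forall f, Ccinf_cylinder f ->
    (exists C : R, forall (h : R) w, 0 < h -> `|h^-1 * (semi P h f w - f w)| <= C) /\
    (forall w, h^-1 * (semi P h f w - f w) @[h --> 0^'+] --> L f w).

(* P is the uniform limit, along finite sets increasing to the lattice, of
   the semigroups PL Lam. *)
Definition box_limit (R : realType) (N n d : nat) (Z : 'I_n -> vfield R N)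
    (PL : set (lattice d) -> kernel_family R N d) (P : kernel_family R N d)
    : Prop :=
  forall (t : R) f, 0 <= t -> cylinder f -> test_function Z f ->
  forall e : R, 0 < e ->
  exists2 Lam0 : set (lattice d), finite_set Lam0 &
    forall Lam, finite_set Lam -> Lam0 `<=` Lam ->
      forall w, `|semi (PL Lam) t f w - semi P t f w| <= e.

Definition infinite_semigroup (R : realType) (N n m d : nat)
    (Z : 'I_n -> vfield R N) (X : 'I_m -> vfield R N) (D : vfield R N)
    (G : 'M[R]_m) (beta : R)
    (alpha : lattice d -> 'I_m -> config R N d -> R)
    (PL : set (lattice d) -> kernel_family R N d) (P : kernel_family R N d)
    : Prop :=
  [/\ forall Lam, finite_set Lam -> markov_semigroup (PL Lam) /\
        has_generator (PL Lam) (L_box X D G beta alpha Lam),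
      markov_semigroup P
    & box_limit Z PL P].

Definition gradient_bounds (R : realType) (N n d : nat)
    (Z : 'I_n -> vfield R N) (P : kernel_family R N d) (kappa : R) : Prop :=
  forall (t : R) f, 0 < t -> test_function Z f ->
    [/\ config_differentiable (semi P t f),
        forall w, (Gamma Z (semi P t f) w <=
          (expR (- kappa * t))%:E * \int[P t w]_w' Gamma Z f w')%E
      & forall w,
        ((semi P t (fun w' => f w' ^+ 2)%R w - semi P t f w ^+ 2)%:E <=
          (2 / kappa * (1 - expR (- kappa * t)))%:E *
            \int[P t w]_w' Gamma Z f w')%E].

Definition dilation_threshold (R : realType) (N n m d : nat)
    (Z : 'I_n -> vfield R N) (X : 'I_m -> vfield R N) (D : vfield R N)
    (G : 'M[R]_m) (alpha : lattice d -> 'I_m -> config R N d -> R) (beta0 : R)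
    : Prop :=
  forall beta, beta0 < beta ->
  exists2 kappa : R, 0 < kappa &
    forall PL P, infinite_semigroup Z X D G beta alpha PL P ->
      gradient_bounds Z P kappa.

Definition weights_summable (R : realType) (d zeta : nat) : Prop :=
  (\esum_(k in [set: lattice d]) (((1 + lnorm k)%:R ^- zeta : R)%:E)
     < +oo)%E.

Definition Omega (R : realType) (N M d : nat) (X : 'I_M -> vfield R N)
    (zeta : nat) : set (config R N d) :=
  [set w | (\esum_(k in [set: lattice d])
     (((1 + lnorm k)%:R ^- zeta)%:E * control_dist X (w k) 0) < +oo)%E].

Definition invariant (R : realType) (N d : nat) (P : kernel_family R N d)
    (nu : probability (config R N d) R) : Prop :=
  forall (t : R) A, 0 <= t -> measurable A -> (\int[nu]_w P t w A)%E = nu A.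

Definition carried_by (R : realType) (N d : nat)
    (nu : probability (config R N d) R) (A : set (config R N d)) : Prop :=
  {ae nu, forall w, A w}.

Definition unique_invariant (R : realType) (N d : nat)
    (P : kernel_family R N d) (A : set (config R N d))
    (nu : probability (config R N d) R) : Prop :=
  [/\ invariant P nu, carried_by nu A
    & forall mu : probability (config R N d) R,
        invariant P mu -> carried_by mu A ->
        forall B, measurable B -> mu B = nu B].

Definition ergodic_limit (R : realType) (N d : nat)
    (P : kernel_family R N d) (A : set (config R N d))
    (nu : probability (config R N d) R) : Prop :=
  forall f : config R N d -> R,
    continuous f -> (exists C : R, forall w, `|f w| <= C) ->
    forall w, A w -> semi P t f w @[t --> +oo] --> \int[nu]_w' f w'.

(* Main.v *)
Require Import Defs.
From HB Require Import structures.
From mathcomp Require Import all_boot all_order all_algebra.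
From mathcomp Require Import all_classical all_reals all_analysis.
From mathcomp Require Import measurable_realfun ring lra.

Set Implicit Arguments.
Unset Strict Implicit.
Unset Printing Implicit Defensive.

Import Order.TTheory GRing.Theory Num.Theory.
Import numFieldNormedType.Exports.

Local Open Scope classical_set_scope.
Local Open Scope ring_scope.

(** The invariant measure satisfies a Poincare inequality with a sup-type
    energy, and the exponential moment is obtained from it by the halving
    argument of Aida and Stroock (see also Gromov and Milman).

    Let [t] tend to infinity in the local Poincare inequality for [P t], at a
    point [w0] of [Omega], where [semi P t F w0] converges to [nu F] for bounded
    continuous [F].  The right-hand side contains [P t (Gamma F)], and [Gamma F]
    need not be continuous, so no limit is available for it.  If however
    [Gamma F <= a F^2] pointwise, then [P t (Gamma F) <= a P t (F^2)], whose
    limit is known, and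
    [nu (F^2) - (nu F)^2 <= (2 / kappa) a nu (F^2)] ([stationary_poincare]).

    Exponentials are functions of this kind: by the chain rule, for bounded [g]
    with [Gamma g <= A <= kappa], [F = expR (g / 2)] satisfies
    [Gamma F <= (A / 4) F^2].  The inequality reads
    [nu (e^g) (1 - A / (2 kappa)) <= (nu (e^(g/2)))^2], hence
    [nu (e^g) <= e^(A / kappa) (nu (e^(g/2)))^2] ([mgf_halving]).  Halving [g]
    divides the energy bound by four while the square only doubles exponents,
    so under iteration the error terms form a convergent geometric series:
    [nu (e^g) <= e^(2 A / kappa) (nu (e^(g / 2^k)))^(2^k)]
    ([mgf_iterated_halving], with a slightly sharper constant).  For bounded [g]
    the last factor tends to [e^(nu g)], by the second-order expansion of the
    exponential; this gives [nu (e^g) <= e^(2 A / kappa + nu g)]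
    ([mgf_bounded_le]).

    An integrable [g] is approximated by bounded functions [x / (1 + (h x)^2)]
    of [g], which do not increase [Gamma]; Fatou's lemma on the left and
    dominated convergence on the right remove the truncation
    ([mgf_integrable_le]).  With [g = delta f] and
    [A / kappa = (delta^2 / kappa) sup Gamma f <= 1], the bound
    [e^(2 A / kappa)] is at most [e * e^(A / kappa)], so [Const = e^2] leaves
    room for the strict inequality. *)

(** * Integration of functions of a configuration *)

Lemma continuous_config_measurable (R : realType) (N d : nat)
  (f : config R N d -> R) : continuous f -> measurable_fun setT f.
Proof.
move=> /continuousP cf; apply: (measurability _ (RGenOpens.measurableE R)).
move=> _ [_ [a [b ->] <-]]; rewrite setTI.
apply: sub_sigma_algebra.
exact/cf/interval_open.
Qed.

(** The integral of a nonnegative function is a supremum over the simple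
    functions below it, and so is monotone on all functions.  This form applies
    to [Gamma Z F], about whose measurability nothing is assumed. *)
Lemma ge0_le_integral_nonmeasurable (dd : measure_display) (T : measurableType dd)
  (R : realType) (mu : {measure set T -> \bar R}) (f g : T -> \bar R) :
  (forall x, 0 <= f x)%E -> (forall x, f x <= g x)%E ->
  (\int[mu]_x f x <= \int[mu]_x g x)%E.
Proof.
move=> f0 fg; rewrite !ge0_integralTE//; last by move=> x; exact: le_trans (fg x).
by apply: ereal_sup_le => _ [h hf <-]; exists h => // x; exact: le_trans (fg x).
Qed.

Lemma integrable_bounded_continuous (R : realType) (N d : nat)
  (mu : {measure set (config R N d) -> \bar R}) (f : config R N d -> R) (C : R) :
  (mu setT < +oo)%E -> continuous f -> (forall w, `|f w| <= C) ->
  mu.-integrable setT (EFin \o f).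
Proof.
move=> mufin cf fC; apply: measurable_bounded_integrable => //.
- exact: continuous_config_measurable.
- exists C; split; first exact: num_real.
  by move=> y Cy w _; rewrite /= (le_trans (fC w))// ltW.
Qed.

Lemma probability_setT_lty (dd : measure_display) (T : measurableType dd)
  (R : realType) (nu : probability T R) : (nu setT < +oo)%E.
Proof. exact: le_lt_trans (probability_le1 nu measurableT) (ltry _). Qed.

Lemma ae_probability_exists (dd : measure_display) (T : measurableType dd)
  (R : realType) (nu : probability T R) (A : set T) :
  {ae nu, forall w, A w} -> exists w, A w.
Proof.
move=> [B [mB B0 AB]]; apply: contrapT => nA; have := probability_setT nu.
rewrite (_ : setT = B).
  by rewrite B0 => /eqP; rewrite eqe eq_sym oner_eq0.
by apply/seteqP; split=> // w _; apply: AB => /= Aw; apply: nA; exists w.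
Qed.

(** * Chain rule for the carre du champ *)

Lemma disp0 (R : realType) (N d : nat) (k : lattice d) :
  disp k (0 : 'rV[R]_N) = 0.
Proof. by apply/funext => j; rewrite /disp if_same. Qed.

(** Differentiability in a single coordinate is the instance of a family of
    sites with one element. *)
Lemma site_differentiable (R : realType) (N d : nat) (f : config R N d -> R)
  (k : lattice d) (w : config R N d) : config_differentiable f ->
  differentiable (fun x : 'rV[R]_N => f (w + disp k x)) (0 : 'rV[R]_N).
Proof.
move=> [_ /(_ w 1%N (fun=> k))]; congr (differentiable _ _).
apply/funext => v; rewrite big_ord1; congr (f (w + disp k _)).
by apply/rowP => j; rewrite mxE.
Qed.

Lemma config_differentiable_comp (R : realType) (N d : nat) (phi dphi : R -> R)
  (f : config R N d -> R) : (forall x : R, is_derive x (1 : R) phi (dphi x)) ->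
  config_differentiable f -> config_differentiable (phi \o f).
Proof.
move=> Dphi [cf df]; have dif x : differentiable phi x.
  by apply/derivable1_diffP; case: (Dphi x).
split=> [w|w p s].
  exact: (continuous_comp (cf w) (differentiable_continuous (dif _))).
exact: (@differentiable_comp _ _ _ _ (fun v : 'M[R]_(p, N) =>
  f (w + \sum_(i < p) disp (s i) (row i v))) phi).
Qed.

Lemma site_vfield_comp (R : realType) (N d : nat) (phi dphi : R -> R)
  (f : config R N d -> R) (V : vfield R N) (k : lattice d) (w : config R N d) :
  (forall x : R, is_derive x (1 : R) phi (dphi x)) ->
  config_differentiable f ->
  site_vfield V k (phi \o f) w = dphi (f w) * site_vfield V k f w.
Proof.
move=> Dphi df; rewrite /site_vfield /site_derive.
have dif x : differentiable phi x.
  by apply/derivable1_diffP; case: (Dphi x).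
have dfk := site_differentiable k w df.
set h := fun x : 'rV[R]_N => f (w + disp k x) in dfk *.
have h0 : h 0 = f w by rewrite /h disp0 addr0.
rewrite deriveE; last exact: (@differentiable_comp _ _ _ _ h phi).
rewrite (@diff_comp _ _ _ _ h phi)// deriveE//= h0.
have := @derive_val _ _ _ _ _ _ _ (Dphi (f w)); rewrite deriveE// => <-.
set y := 'd h 0 _; have -> : 'd phi (f w) y = 'd phi (f w) (y *: (1 : R)).
  by congr ('d phi (f w) _); rewrite /GRing.scale /= mulr1.
by rewrite linearZ mulrC.
Qed.

Lemma Gamma_ge0 (R : realType) (N n d : nat) (Z : 'I_n -> vfield R N)
  (f : config R N d -> R) (w : config R N d) : (0 <= Gamma Z f w)%E.
Proof. by apply: esum_ge0 => k _; rewrite lee_fin sumr_ge0// => r _; rewrite sqr_ge0. Qed.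

(** [Gamma] is quadratic in first derivatives, so the chain rule multiplies each
    of its terms by the same factor. *)
Lemma Gamma_comp_le (R : realType) (N n d : nat) (Z : 'I_n -> vfield R N)
  (phi dphi : R -> R) (f : config R N d -> R) (w : config R N d) :
  (forall x : R, is_derive x (1 : R) phi (dphi x)) ->
  config_differentiable f ->
  (Gamma Z (phi \o f) w <= (dphi (f w) ^+ 2)%:E * Gamma Z f w)%E.
Proof.
move=> Dphi df; apply: ge_ereal_sup => _ [S [finS _] <-].
under eq_fsbigr => k _.
  under eq_bigr => r _ do rewrite (site_vfield_comp _ _ _ Dphi df) exprMn.
  rewrite -mulr_sumr EFinM.
  over.
rewrite /= -ge0_mule_fsumr; last first.
  by move=> k; rewrite lee_fin sumr_ge0// => r _; rewrite sqr_ge0.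
apply: lee_wpmul2l; rewrite ?lee_fin ?sqr_ge0//.
by apply: ereal_sup_ubound; exists S.
Qed.

Lemma sup_Gamma_lty (R : realType) (N n d : nat) (Z : 'I_n -> vfield R N)
  (f : config R N d -> R) (A : R) :
  (forall w, Gamma Z f w <= A%:E)%E -> (sup_Gamma Z f < +oo)%E.
Proof.
move=> fA; apply: (@le_lt_trans _ _ A%:E); last exact: ltry.
by apply: ge_ereal_sup => _ [w _ <-].
Qed.

Lemma test_function_bounded (R : realType) (N n d : nat) (Z : 'I_n -> vfield R N)
  (f : config R N d -> R) (C A : R) :
  config_differentiable f -> (forall w, `|f w| <= C) ->
  (forall w, Gamma Z f w <= A%:E)%E -> test_function Z f.
Proof. by move=> df fC fA; split=> //; [exists C|exact: sup_Gamma_lty fA]. Qed.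

Lemma is_derive_scale (R : realType) (a x : R) :
  is_derive x (1 : R) (fun y => a * y) a.
Proof.
have H := is_deriveZ a (is_derive_id x (1 : R)).
by apply: (is_derive_eq H); rewrite /GRing.scale /= mulr1.
Qed.

Lemma is_derive_expR_scale (R : realType) (a x : R) :
  is_derive x (1 : R) (fun y => expR (a * y)) (a * expR (a * x)).
Proof.
rewrite mulrC.
exact: (is_derive1_comp (is_derive_expR (a * x)) (is_derive_scale a x)).
Qed.

Lemma Gamma_scale_le (R : realType) (N n d : nat) (Z : 'I_n -> vfield R N)
  (f : config R N d -> R) (A a : R) (w : config R N d) :
  config_differentiable f -> (Gamma Z f w <= A%:E)%E ->
  (Gamma Z (fun w => a * f w)%R w <= (a ^+ 2 * A)%:E)%E.
Proof.
move=> df fA.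
apply: (le_trans (Gamma_comp_le Z w (is_derive_scale a) df)).
by rewrite [leRHS]EFinM lee_wpmul2l// lee_fin sqr_ge0.
Qed.

(** * Elementary bounds on the exponential *)

Lemma expR_half_mul (R : realType) (x : R) : expR (x / 2) ^+ 2 = expR x.
Proof. by rewrite -expRM_natl; congr expR; rewrite mulr_natl -mulr_natr divfK. Qed.

(** Since [expR (2 x) >= 1 + 2 x], the right-hand side is at least
    [1 + x (1 - 2 x)].  The endpoint [1/2] is reached for [A = kappa] in
    [mgf_halving]. *)
Lemma inv_1Bx_le_expR2x (R : realType) (x : R) : 0 <= x -> x <= 2^-1 ->
  1 <= (1 - x) * expR (2 * x).
Proof.
move=> x0 x2; apply: (@le_trans _ _ ((1 - x) * (1 + 2 * x))); first nra.
by apply: ler_wpM2l; [lra|exact: expR_ge1Dx].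
Qed.

(** From [expR (- x) >= 1 - x], because [(1 - x) (1 + x + 2 x^2) >= 1] on this
    interval. *)
Lemma expR_le_quadratic (R : realType) (x : R) : `|x| <= 2^-1 ->
  expR x <= 1 + x + 2 * x ^+ 2.
Proof.
rewrite ler_norml => /andP[x0 x1].
have x2 : 0 <= x ^+ 2 * (1 - 2 * x) by rewrite mulr_ge0 ?sqr_ge0//; lra.
have h : expR x * (1 - x) <= 1.
  rewrite -[leRHS](expRxMexpNx_1 x) ler_wpM2l ?expR_ge0//.
  exact: expR_ge1Dx.
apply: (@le_trans _ _ (expR x * ((1 - x) * (1 + x + 2 * x ^+ 2)))).
  by apply: ler_peMr; [exact: expR_ge0|lra].
by rewrite mulrA; apply: ler_piMl => //; nra.
Qed.

(** * Poincare inequality for the stationary measure *)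

(** The hypothesis [Gamma Z F <= a F^2] replaces [P t (Gamma Z F)] by a multiple
    of [P t (F^2)], the integral of a bounded continuous function, for which the
    limit as [t] tends to infinity at [w0] is known. *)
Lemma stationary_poincare (R : realType) (N n d : nat)
  (Z : 'I_n -> vfield R N) (P : kernel_family R N d) (kappa : R)
  (nu : probability (config R N d) R) (A : set (config R N d))
  (w0 : config R N d) (F : config R N d -> R) (a : R) :
  0 < kappa -> gradient_bounds Z P kappa -> ergodic_limit P A nu -> A w0 ->
  test_function Z F ->
  0 <= a -> (forall w, Gamma Z F w <= (a * F w ^+ 2)%:E)%E ->
  \int[nu]_w (F w ^+ 2) - (\int[nu]_w F w) ^+ 2
    <= 2 / kappa * a * \int[nu]_w (F w ^+ 2).
Proof.
move=> k0 Pb lim Aw0 tF a0 FG.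
have [[cF _] [C FC] _] := tF.
have cF2 : continuous (fun w => F w ^+ 2).
  by move=> w; exact: (@continuous_comp _ _ _ F (fun x => x ^+ 2) _ (cF w)
    (@exprn_continuous _ 2 _)).
have F2C w : `|F w ^+ 2| <= C ^+ 2.
  by rewrite normrX ler_sqr ?nnegrE// (le_trans (normr_ge0 (F w))).
have limF := lim F cF (ex_intro _ C FC) _ Aw0.
have limF2 := lim _ cF2 (ex_intro _ (C ^+ 2) F2C) _ Aw0.
(* Both sides of the local Poincare inequality at [w0] converge. *)
have L1 : semi P t (fun w => F w ^+ 2) w0 - semi P t F w0 ^+ 2 @[t --> +oo]
    --> \int[nu]_w (F w ^+ 2) - (\int[nu]_w F w) ^+ 2.
  apply: cvgB limF2 _.
  exact: (cvgM limF limF).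
have L2 : 2 / kappa * a * semi P t (fun w => F w ^+ 2) w0 @[t --> +oo]
    --> 2 / kappa * a * \int[nu]_w (F w ^+ 2).
  exact: (cvgM (cvg_cst _) limF2).
apply: (ler_cvg_to L1 L2).
near=> t; have t0 : 0 < t by near: t; exact: nbhs_pinfty_gt.
have [_ _ /(_ w0)] := Pb t F t0 tF.
have mufin : (P t w0 setT < +oo)%E by rewrite prob_kernel ltry.
have iF2 := integrable_bounded_continuous mufin cF2 F2C.
have GF : (\int[P t w0]_w Gamma Z F w <=
    (a * semi P t (fun w => F w ^+ 2) w0)%:E)%E.
  apply: (le_trans (ge0_le_integral_nonmeasurable _ (Gamma_ge0 Z F) FG)).
  under eq_integral do rewrite EFinM.
  by rewrite integralZl// EFinM /semi fineK// integrable_fin_num.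
have S0 : 0 <= semi P t (fun w => F w ^+ 2) w0.
  by apply: Rintegral_ge0 => w _; rewrite sqr_ge0.
have e0 : 0 <= 2 / kappa * (1 - expR (- kappa * t)).
  rewrite mulr_ge0 ?divr_ge0 ?ltW// subr_gt0 expR_lt1 mulNr oppr_lt0; exact: mulr_gt0.
move=> /le_trans/(_ (lee_wpmul2l _ GF)).
rewrite lee_fin => /(_ e0); rewrite -EFinM lee_fin => /le_trans; apply.
rewrite -!mulrA; apply: ler_wpM2l => //. apply: ler_wpM2l; first by rewrite invr_ge0 ltW.
(* What remains is [1 - expR (- kappa * t) <= 1]. *)
by rewrite ler_piMl ?mulr_ge0// lerBlDl lerDr expR_ge0.
Unshelve. all: by end_near. Qed.

(** * Exponential moments of bounded functions *)

(** The Poincare inequality applied to [F = expR (g / 2)], for which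
    [F^2 = expR g] and [Gamma Z F <= (A / 4) F^2].  It gives the factor
    [1 - x] with [x = A / (2 kappa) <= 1/2] in front of [nu (e^g)], and
    [1 <= (1 - x) expR (2 x)] moves it to the right. *)
Lemma mgf_halving (R : realType) (N n d : nat)
  (Z : 'I_n -> vfield R N) (P : kernel_family R N d) (kappa : R)
  (nu : probability (config R N d) R) (S : set (config R N d))
  (w0 : config R N d) (g : config R N d -> R) (C A : R) :
  0 < kappa -> gradient_bounds Z P kappa -> ergodic_limit P S nu -> S w0 ->
  config_differentiable g -> (forall w, `|g w| <= C) ->
  0 <= A <= kappa -> (forall w, Gamma Z g w <= A%:E)%E ->
  \int[nu]_w expR (g w)
    <= expR (A / kappa) * (\int[nu]_w expR (2^-1 * g w)) ^+ 2.
Proof.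
move=> k0 Pb lim Sw dg gC /andP[A0 Ak] gA.
pose F w := expR (2^-1 * g w).
have F2 w : F w ^+ 2 = expR (g w).
  by rewrite /F [2^-1 * _]mulrC expR_half_mul.
have dF : config_differentiable F.
  exact: (config_differentiable_comp (is_derive_expR_scale 2^-1) dg).
have FC w : `|F w| <= expR (2^-1 * C).
  rewrite ger0_norm ?expR_ge0// ler_expR ler_wpM2l//.
  exact: le_trans (ler_norm _) (gC w).
have FG w : (Gamma Z F w <= (A / 4 * F w ^+ 2)%:E)%E.
  apply: (le_trans (Gamma_comp_le Z w (is_derive_expR_scale 2^-1) dg)).
  apply: le_trans (lee_wpmul2l _ (gA w)) _; first by rewrite lee_fin sqr_ge0.
  by rewrite -EFinM lee_fin -/(F w) le_eqVlt; apply/orP; left; apply/eqP; field.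
have FA w : (Gamma Z F w <= (A / 4 * expR (2^-1 * C) ^+ 2)%:E)%E.
  apply: (le_trans (FG w)); rewrite lee_fin ler_wpM2l ?divr_ge0//.
  rewrite ler_sqr ?nnegrE ?expR_ge0//.
  exact: le_trans (ler_norm _) (FC w).
have tF := test_function_bounded dF FC FA.
have A4 : 0 <= A / 4 by rewrite divr_ge0.
have := stationary_poincare k0 Pb lim Sw tF A4 FG.
under eq_Rintegral do rewrite F2.
set E := \int[nu]_w expR (g w); set m := \int[nu]_w _ => PE.
have E0 : 0 <= E by apply: Rintegral_ge0 => w _; exact: expR_ge0.
pose x := A / (2 * kappa).
have x0 : 0 <= x by rewrite divr_ge0// mulr_ge0// ltW.
have x2 : x <= 2^-1.
  by rewrite ler_pdivrMr ?mulr_gt0// mulrA mulVf// mul1r.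
have Exm : E * (1 - x) <= m ^+ 2.
  have xE : 2 / kappa * (A / 4) = x by rewrite /x; field; rewrite gt_eqF.
  by move: PE; rewrite xE => PE; lra.
have -> : A / kappa = 2 * x by rewrite /x; field; rewrite gt_eqF.
apply: (@le_trans _ _ (E * ((1 - x) * expR (2 * x)))).
  by rewrite ler_peMr// inv_1Bx_le_expR2x.
by rewrite mulrA mulrC ler_wpM2l// expR_ge0.
Qed.

(** One halving of [g / 2^j] costs [A / (4^j kappa)] in the exponent, and the
    [2^j]-th power turns this into [A / (2^j kappa)]; the geometric series sums
    to [2 - 2 / 2^k]. *)
Lemma mgf_iterated_halving (R : realType) (N n d : nat)
  (Z : 'I_n -> vfield R N) (P : kernel_family R N d) (kappa : R)
  (nu : probability (config R N d) R) (S : set (config R N d))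
  (w0 : config R N d) (k : nat) (g : config R N d -> R) (C A : R) :
  0 < kappa -> gradient_bounds Z P kappa -> ergodic_limit P S nu -> S w0 ->
  config_differentiable g -> (forall w, `|g w| <= C) ->
  0 <= A <= kappa -> (forall w, Gamma Z g w <= A%:E)%E ->
  \int[nu]_w expR (g w)
    <= expR (A / kappa * (2 - 2 * 2^-1 ^+ k)) *
       (\int[nu]_w expR (2^-1 ^+ k * g w)) ^+ (2 ^ k).
Proof.
move=> k0 Pb lim Sw; elim: k g C A => [|k IH] g C A dg gC Ak gA.
  rewrite expr0 mulr1 subrr mulr0 expR0 mul1r expn0 expr1.
  by under [leRHS]eq_Rintegral do rewrite mul1r.
apply: (le_trans (mgf_halving k0 Pb lim Sw dg gC Ak gA)).
have /andP[A0 Ak'] := Ak.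
have dg2 : config_differentiable (fun w => 2^-1 * g w).
  exact: (config_differentiable_comp (is_derive_scale 2^-1) dg).
have g2C w : `|2^-1 * g w| <= 2^-1 * C.
  by rewrite normrM ger0_norm// ler_wpM2l.
have Ak2 : 0 <= 2^-1 ^+ 2 * A <= kappa by apply/andP; split; lra.
have := IH _ _ _ dg2 g2C Ak2 (fun w => Gamma_scale_le 2^-1 dg (gA w)).
under [X in _ <= _ * X ^+ _ -> _]eq_Rintegral do rewrite mulrA -exprSr.
set m := \int[nu]_w expR (2^-1 ^+ k.+1 * g w).
set m1 := \int[nu]_w _ => h.
have m10 : 0 <= m1 by apply: Rintegral_ge0 => w _; exact: expR_ge0.
have m0 : 0 <= m by apply: Rintegral_ge0 => w _; exact: expR_ge0.
have h2 : m1 ^+ 2 <= (expR (2^-1 ^+ 2 * A / kappa * (2 - 2 * 2^-1 ^+ k)) *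
       m ^+ (2 ^ k)) ^+ 2.
  by rewrite ler_sqr// nnegrE mulr_ge0 ?expR_ge0// exprn_ge0.
apply: (le_trans (ler_wpM2l (expR_ge0 _) h2)).
rewrite exprMn -exprM -expnSr mulrA -expRM_natl -expRD.
rewrite ler_wpM2r ?exprn_ge0// ler_expR [2^-1 ^+ k.+1]exprS le_eqVlt.
apply/orP; left; apply/eqP; by field; rewrite gt_eqF.
Qed.

(** For large [k] the function [g / 2^k] is small, and the second-order bound on
    the exponential shows that [(nu (e^(g / 2^k)))^(2^k)] is at most
    [expR (nu g + 2 C^2 / 2^k)], whose limit is [expR (nu g)]. *)
Lemma mgf_bounded_le (R : realType) (N n d : nat)
  (Z : 'I_n -> vfield R N) (P : kernel_family R N d) (kappa : R)
  (nu : probability (config R N d) R) (S : set (config R N d))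
  (w0 : config R N d) (g : config R N d -> R) (C A : R) :
  0 < kappa -> gradient_bounds Z P kappa -> ergodic_limit P S nu -> S w0 ->
  config_differentiable g -> (forall w, `|g w| <= C) ->
  0 <= A <= kappa -> (forall w, Gamma Z g w <= A%:E)%E ->
  \int[nu]_w expR (g w) <= expR (2 * (A / kappa) + \int[nu]_w g w).
Proof.
move=> k0 Pb lim Sw dg gC Ak gA.
have /andP[A0 _] := Ak; have cg : continuous g by case: dg.
have C0 : 0 <= C := le_trans (normr_ge0 _) (gC w0).
set I := \int[nu]_w g w.
have h2 : (2^-1 : R) ^+ k @[k --> \oo] --> (0 : R).
  by apply: cvg_expr; rewrite ger0_norm// invf_lt1// ltr1n.
have L : expR (2 * (A / kappa) + I + 2 * C ^+ 2 * 2^-1 ^+ k) @[k --> \oo]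
    --> expR (2 * (A / kappa) + I).
  apply: continuous_cvg; first exact: continuous_expR.
  rewrite -[X in _ --> X]addr0 -[X in _ --> _ + X](mulr0 (2 * C ^+ 2)).
  by apply: cvgD; [exact: cvg_cst|apply: cvgM => //; exact: cvg_cst].
apply: (ler_cvg_to (cvg_cst (\int[nu]_w expR (g w))) L).
(* From this point on [|g / 2^k| <= 1/2], the range of [expR_le_quadratic]. *)
have : \forall k \near \oo, C * 2^-1 ^+ k < (2^-1 : R).
  have h3 : C * 2^-1 ^+ k @[k --> \oo] --> (0 : R).
    by rewrite -[X in _ --> X](mulr0 C); apply: cvgM => //; exact: cvg_cst.
  exact: (cvgr_lt _ h3).
apply: filterS => k Ck.
apply: (le_trans (mgf_iterated_halving k k0 Pb lim Sw dg gC Ak gA)).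
set h := 2^-1 ^+ k; rewrite -/h in Ck.
have hp : 0 < h by rewrite exprn_gt0.
have nufin := probability_setT_lty nu.
have ig := integrable_bounded_continuous nufin cg gC.
have gh w : `|h * g w| <= 2^-1.
  rewrite normrM ger0_norm ?(ltW hp)// (le_trans _ (ltW Ck))// mulrC.
  by rewrite ler_wpM2r// ltW.
have m0 : 0 <= \int[nu]_w expR (h * g w).
  by apply: Rintegral_ge0 => w _; exact: expR_ge0.
have iexp : nu.-integrable setT (EFin \o (fun w => expR (h * g w))).
  apply: (@integrable_bounded_continuous _ _ _ _ _ (expR 2^-1)) => //.
    by case: (config_differentiable_comp (is_derive_expR_scale h) dg).
  move=> w; rewrite ger0_norm ?expR_ge0// ler_expR.
  exact: le_trans (ler_norm _) (gh w).
have icst (r : R) : nu.-integrable setT (EFin \o cst r).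
  exact: finite_measure_integrable_cst.
have ihg : nu.-integrable setT (EFin \o (fun w => h * g w)).
  exact: (integrableZl measurableT h ig).
have small : \int[nu]_w expR (h * g w) <= 1 + 2 * (h * C) ^+ 2 + h * I.
  have -> : 1 + 2 * (h * C) ^+ 2 + h * I =
      \int[nu]_w (cst (1 + 2 * (h * C) ^+ 2) w + h * g w).
    rewrite RintegralD// RintegralZl// Rintegral_cst//.
    by rewrite [fine _](congr1 fine (probability_setT nu)) mulr1.
  apply: le_Rintegral => // [|w _].
    exact: (integrableD measurableT (icst _) ihg).
  apply: (le_trans (expR_le_quadratic (gh w))).
  rewrite addrAC lerD2r lerD2l ler_wpM2l// -[leLHS]ger0_norm ?sqr_ge0//.
  rewrite normrX lerXn2r ?nnegrE ?mulr_ge0// ?(ltW hp)//.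
  by rewrite normrM ger0_norm ?(ltW hp)// ler_wpM2l// ltW.
have step : (\int[nu]_w expR (h * g w)) ^+ (2 ^ k) <=
    expR (I + 2 * C ^+ 2 * h).
  have -> : I + 2 * C ^+ 2 * h = (2 ^ k)%:R * (2 * (h * C) ^+ 2 + h * I).
    rewrite natrX /h exprVn; field; rewrite expf_neq0//.
  rewrite expRM_natl lerXn2r ?nnegrE ?expR_ge0//.
  by apply: (le_trans small); rewrite -addrA expR_ge1Dx.
apply: (le_trans (ler_wpM2l (expR_ge0 _) step)).
rewrite -expRD ler_expR addrA !lerD2r mulrC ler_wpM2r ?divr_ge0 ?(ltW k0)//.
by rewrite gerBl mulr_ge0// ltW.
Qed.

(** * Truncation *)

(** The requirements are a bounded smooth function with derivative bounded by [1],
    so that composition does not increase [Gamma], with [|truncate h x| <= |x|]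
    for dominated convergence, and with limit [x] as [h] tends to [0].  A
    rational function makes all of these algebraic. *)
Definition truncate (R : realType) (h x : R) : R := x / (1 + (h * x) ^+ 2).

(** The derivative of [truncate h]. *)
Definition dtruncate (R : realType) (h x : R) : R :=
  (1 - (h * x) ^+ 2) / (1 + (h * x) ^+ 2) ^+ 2.

Lemma truncate_denom_ge1 (R : realType) (h x : R) : 1 <= 1 + (h * x) ^+ 2.
Proof. by rewrite lerDl sqr_ge0. Qed.

Lemma truncate_denom_gt0 (R : realType) (h x : R) : 0 < 1 + (h * x) ^+ 2.
Proof. exact: lt_le_trans ltr01 (truncate_denom_ge1 h x). Qed.

Lemma is_derive_truncate (R : realType) (h x : R) :
  is_derive x (1 : R) (truncate h) (dtruncate h x).
Proof.
have d0 : 1 + (h * x) ^+ 2 != 0 by rewrite gt_eqF ?truncate_denom_gt0.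
have D1 := is_derive_scale h x.
have D2 : is_derive x (1 : R) (fun y => 1 + (h * y) ^+ 2) (2 * h ^+ 2 * x).
  have H := is_deriveD (is_derive_cst (1 : R) x (1 : R)) (is_deriveM D1 D1).
  apply: (is_derive_eq H).
  by rewrite /GRing.scale /=; ring.
have H := is_deriveM (is_derive_id x (1 : R)) 
  (@is_deriveV _ (fun y => 1 + (h * y) ^+ 2) x _ (1 : R) d0 D2).
apply: (is_derive_eq H).
by rewrite /GRing.scale /= /dtruncate; field.
Qed.

Lemma sqr_dtruncate_le1 (R : realType) (h x : R) : dtruncate h x ^+ 2 <= 1.
Proof.
rewrite /dtruncate; set u := (h * x) ^+ 2.
have u0 : 0 <= u by exact: sqr_ge0.
rewrite expr_div_n ler_pdivrMr ?mul1r ?exprn_gt0 ?ltr_wpDr//.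
apply: (@le_trans _ _ ((1 + u) ^+ 2)); first by nra.
by rewrite -[leLHS]expr1 ler_weXn2l// exprn_ege1// lerDl.
Qed.

Lemma norm_truncate_le (R : realType) (h x : R) : `|truncate h x| <= `|x|.
Proof.
have d0 := truncate_denom_gt0 h x.
rewrite normrM normfV (gtr0_norm d0) ler_pdivrMr//.
by rewrite ler_peMr// truncate_denom_ge1.
Qed.

Lemma norm_truncate_bounded (R : realType) (h x : R) : 0 < h ->
  `|truncate h x| <= (2 * h)^-1.
Proof.
move=> h0; have d0 := truncate_denom_gt0 h x.
rewrite normrM normfV (gtr0_norm d0) ler_pdivrMr// mulrC ler_pdivlMr ?mulr_gt0//.
rewrite -[(h * x) ^+ 2]ger0_norm ?sqr_ge0// normrX normrM (gtr0_norm h0).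
(* The bound is [2 h |x| <= 1 + (h |x|)^2]. *)
by have := sqr_ge0 (h * `|x| - 1); lra.
Qed.

Lemma cvg_truncate (R : realType) (h : R^nat) (x : R) :
  h k @[k --> \oo] --> (0 : R) -> truncate (h k) x @[k --> \oo] --> x.
Proof.
move=> h0; rewrite -[X in _ --> X](_ : x / (1 + (0 * x) * (0 * x)) = x); last first.
  by rewrite mul0r mul0r addr0 divr1.
apply: cvgM; first exact: cvg_cst.
apply: cvgV; first by rewrite !mul0r addr0 oner_neq0.
apply: cvgD; first exact: cvg_cst.
by apply: cvgM; apply: cvgM => //; exact: cvg_cst.
Qed.

(** * Exponential moments of integrable functions *)

(** The truncations of [g] satisfy the bounded case with the same [A].  Fatou's
    lemma passes to the limit on the left, where integrability of [expR g] is
    part of the conclusion; on the right the truncations are dominated by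
    [|g|]. *)
Lemma mgf_integrable_le (R : realType) (N n d : nat)
  (Z : 'I_n -> vfield R N) (P : kernel_family R N d) (kappa : R)
  (nu : probability (config R N d) R) (S : set (config R N d))
  (w0 : config R N d) (g : config R N d -> R) (A : R) :
  0 < kappa -> gradient_bounds Z P kappa -> ergodic_limit P S nu -> S w0 ->
  config_differentiable g -> nu.-integrable setT (EFin \o g) ->
  0 <= A <= kappa -> (forall w, Gamma Z g w <= A%:E)%E ->
  (\int[nu]_w (expR (g w))%:E
     <= (expR (2 * (A / kappa) + \int[nu]_w g w))%:E)%E.
Proof.
move=> k0 Pb lim Sw dg ig Ak gA.
have /andP[A0 _] := Ak; have cg : continuous g by case: dg.
pose h (k : nat) : R := k.+1%:R^-1.
have hp k : 0 < h k by rewrite invr_gt0 ltr0n.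
have h0 : h k @[k --> \oo] --> (0 : R) by exact: cvg_harmonic.
pose gk k w := truncate (h k) (g w).
have dgk k : config_differentiable (gk k).
  exact: (config_differentiable_comp (is_derive_truncate (h k)) dg).
have gkC k w : `|gk k w| <= (2 * h k)^-1 by exact: norm_truncate_bounded.
have gkA k w : (Gamma Z (gk k) w <= A%:E)%E.
  apply: (le_trans (Gamma_comp_le Z w (is_derive_truncate (h k)) dg)).
  apply: le_trans (lee_wpmul2l _ (gA w)) _; first by rewrite lee_fin sqr_ge0.
  by rewrite -EFinM lee_fin ler_piMl// sqr_dtruncate_le1.
have mgk k : measurable_fun setT (gk k).
  by apply: continuous_config_measurable; case: (dgk k).
have igk k : nu.-integrable setT (EFin \o gk k).
  apply: integrable_bounded_continuous (gkC k).
    exact: probability_setT_lty.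
  by case: (dgk k).
have mexp (u : config R N d -> R) : measurable_fun setT u ->
    measurable_fun setT (EFin \o (fun w => expR (u w))).
  by move=> mu; apply/measurable_EFinP; exact: measurableT_comp.
have bound k : (\int[nu]_w (expR (gk k w))%:E
    <= (expR (2 * (A / kappa) + \int[nu]_w gk k w))%:E)%E.
  have := mgf_bounded_le k0 Pb lim Sw (dgk k) (gkC k) Ak (gkA k).
  rewrite -lee_fin /Rintegral fineK//; apply: integrable_fin_num => //.
  apply: (@integrable_bounded_continuous _ _ _ _ _ (expR (2 * h k)^-1)).
  - exact: probability_setT_lty.
  - by move=> w; apply: continuous_comp;
      [case: (dgk k) => c _; exact: c|exact: continuous_expR].
  - move=> w; rewrite ger0_norm ?expR_ge0// ler_expR.
    exact: le_trans (ler_norm _) (gkC k w).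
have cvgI : \int[nu]_w gk k w @[k --> \oo] --> \int[nu]_w g w.
  have [|||||_ _] := @dominated_convergence _ _ _ nu _ measurableT
    (fun k w => (gk k w)%:E) (EFin \o g) (fun w => `|(g w)%:E|%E).
  - by move=> k; exact/measurable_EFinP.
  - by apply/measurable_EFinP; exact: continuous_config_measurable.
  - by apply: aeW => w _; apply: cvg_EFin; [exact: nearW|exact: cvg_truncate].
  - exact: integrable_abse.
  - by apply: aeW => w k _; rewrite lee_fin norm_truncate_le.
  move=> H; apply: fine_cvg.
  by rewrite fineK//; exact: integrable_fin_num.
have cvgB : (expR (2 * (A / kappa) + \int[nu]_w gk k w))%:E @[k --> \oo] -->
    (expR (2 * (A / kappa) + \int[nu]_w g w))%:E.
  apply: cvg_EFin; first exact: nearW.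
  apply: continuous_cvg; first exact: continuous_expR.
  by apply: cvgD => //; exact: cvg_cst.
have fat := @fatou _ _ _ nu _ measurableT (fun k w => (expR (gk k w))%:E)
  (fun k => mexp _ (mgk k)) (fun k w _ => expR_ge0 _).
have limE w : limn_einf (fun k => (expR (gk k w))%:E) = (expR (g w))%:E.
  apply: (cvg_limn_einf_sup _).1.
  apply: cvg_EFin; first exact: nearW.
  apply: continuous_cvg; first exact: continuous_expR.
  exact: cvg_truncate.
under eq_integral do rewrite -limE.
apply: (le_trans fat).
rewrite -[leRHS](cvg_limn_einf_sup cvgB).1.
rewrite !limn_einf_lim; apply: lee_lim; try exact: is_cvg_einfs.
apply: nearW => k; apply: le_ereal_inf_tmp => _ [j /= kj <-].
apply: le_trans (bound j).
by apply: ereal_inf_lbound; exists j.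
Qed.

(** * The deviation bound *)

Theorem corollary3p9 (R : realType) (N n M m d K : nat)
  (N_gt0 : (0 < N)%N) (n_gt0 : (0 < n)%N) (M_gt0 : (0 < M)%N)
  (m_gt0 : (0 < m)%N) (leNn : (N <= n)%N) (lemM : (m <= M)%N)
  (leMn : (M <= n)%N) (K_gt1 : (1 < K)%N)
  (X : 'I_M -> vfield R N) (X_smooth : forall i, smooth_vfield (X i))
  (X_hormander : hormander X K)
  (Z : 'I_n -> vfield R N) (Z_adapted : adapted_family K leMn X Z)
  (Xm : 'I_m -> vfield R N) (XmE : forall j, Xm j = X (widen_ord lemM j))
  (c : 'I_n -> 'I_m -> 'I_n -> R)
  (ZX_comm : forall k j x,
    lie_bracket (Z k) (Xm j) x = \sum_(l < n) c k j l *: Z l x)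
  (D : vfield R N) (D_smooth : smooth_vfield D)
  (lambda : 'I_n -> R) (lambda_gt0 : forall k, 0 < lambda k)
  (ZD_comm : forall k x, lie_bracket (Z k) D x = lambda k *: Z k x)
  (G : 'M[R]_m) (G_posdef : sym_part_plus_id_posdef G)
  (Rg : nat) (alpha : lattice d -> 'I_m -> config R N d -> R)
  (alpha_smooth : forall k i, config_smooth (alpha k i))
  (alpha_range : finite_range Rg Z alpha)
  (alpha_bounded : bounded_coefficients Z alpha)
  (Gamma_bar_le : forall f : config R N d -> R, config_differentiable f ->
    forall w, (Gamma_bar Xm G f w <= Gamma Z f w)%E)
  (beta0 : R) (beta0_gt0 : 0 < beta0)
  (beta0_threshold : dilation_threshold Z Xm D G alpha beta0)
  (beta : R) (beta_gt : beta0 < beta)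
  (PL : set (lattice d) -> kernel_family R N d) (P : kernel_family R N d)
  (P_semigroup : infinite_semigroup Z Xm D G beta alpha PL P)
  (kappa : R) (kappa_gt0 : 0 < kappa)
  (P_bounds : gradient_bounds Z P kappa)
  (zeta : nat) (zeta_summable : weights_summable R d zeta)
  (nu : probability (config R N d) R)
  (nu_unique : unique_invariant P (Omega X zeta) nu)
  (nu_limit : ergodic_limit P (Omega X zeta) nu) :
  exists2 Const : R, 0 < Const &
    forall (delta : R) (f : config R N d -> R),
      config_differentiable f ->
      nu.-integrable setT (EFin \o f) ->
      ((delta ^+ 2 / kappa)%:E * sup_Gamma Z f <= 1)%E ->
      (\int[nu]_w (expR (delta * f w))%:E <
        Const%:E * expeR ((delta ^+ 2 / kappa)%:E * sup_Gamma Z f) *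
          expeR (delta%:E * \int[nu]_w (f w)%:E))%E.
Proof.
exists (expR 2); first exact: expR_gt0.
move=> delta f df fint fS.
have [nuinv nuOmega _] := nu_unique.
have [w0 Ow0] := ae_probability_exists nuOmega.
have If : (\int[nu]_w (f w)%:E)%E = (\int[nu]_w f w)%:E.
  by rewrite fineK//; exact: integrable_fin_num.
have Gpos : (0 <= sup_Gamma Z f)%E.
  by apply: (le_trans (Gamma_ge0 Z f w0)); apply: ereal_sup_ubound; exists w0.
set g := fun w => delta * f w.
have dg : config_differentiable g.
  exact: (config_differentiable_comp (is_derive_scale delta) df).
have ig : nu.-integrable setT (EFin \o g).
  exact: (integrableZl measurableT delta fint).
have Ig : \int[nu]_w g w = delta * \int[nu]_w f w by rewrite RintegralZl.
(* [A] is a finite bound of the energy of [g = delta f].  For [delta = 0] the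
   supremum of [Gamma Z f] may be infinite, but it is multiplied by [0]. *)
have [A [Ak gA eA]] : exists A, [/\ 0 <= A <= kappa,
    forall w, (Gamma Z g w <= A%:E)%E
  & ((delta ^+ 2 / kappa)%:E * sup_Gamma Z f = (A / kappa)%:E)%E].
  have [d0|d0] := eqVneq delta 0.
    exists 0; split; first by rewrite lexx ltW.
      move=> w; apply: (le_trans (Gamma_comp_le Z w (is_derive_scale delta) df)).
      by rewrite d0 expr0n mul0e.
    by rewrite d0 expr0n !mul0r mul0e.
  have dk : 0 < delta ^+ 2 / kappa.
    by rewrite divr_gt0// lt0r sqrf_eq0 d0 sqr_ge0.
  move: Gpos fS; have Gle w : (Gamma Z f w <= sup_Gamma Z f)%E.
    by apply: ereal_sup_ubound; exists w.
  case: (sup_Gamma Z f) Gle => [s|_ _|_]//=; last first.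
    by rewrite gt0_muley ?lte_fin// leye_eq.
  move=> Gle; rewrite -EFinM !lee_fin => s0 sk; exists (delta ^+ 2 * s); split.
  - rewrite mulr_ge0 ?sqr_ge0//=.
    by move: sk; rewrite mulrAC ler_pdivrMr// mul1r.
  - by move=> w; exact: Gamma_scale_le.
  - by rewrite mulrAC.
have /andP[A0 Ak'] := Ak.
apply: (le_lt_trans (mgf_integrable_le kappa_gt0 P_bounds nu_limit Ow0 dg ig Ak gA)).
rewrite eA If Ig -EFinM /= lte_fin -!expRD ltr_expR ltrD2r.
have : A / kappa <= 1 by rewrite ler_pdivrMr// mul1r.
lra.
Qed.
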